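(* For any set $A\subset [0,\infty)$ with $0\in A$, there exists a set $X\subset \mathbb{R}$ such that $S(X)=A$.
   Context: For a metric space $(X,d)$, the center of distances of $X$ is the set $S(X):=\{a\in[0,\infty) : \forall x\in X\ \exists y\in X\ d(x,y)=a\}$. Subsets $X\subset\mathbb{R}$ are considered with the usual metric $d(x,y)=|x-y|$. *)

(* Defs.v *)
From mathcomp Require Import all_boot all_order all_algebra.
From mathcomp Require Import all_classical all_reals all_analysis.

Set Implicit Arguments.
Unset Strict Implicit.
Unset Printing Implicit Defensive.

Import Order.TTheory GRing.Theory Num.Theory.
Import numFieldNormedType.Exports.

Local Open Scope classical_set_scope.
Local Open Scope ring_scope.

(* The metric space is a subset X of an ambient metric space M, carrying the
   restricted metric; X = setT gives the whole space M. *)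
Definition center_of_distances (R : numDomainType) (M : metricType R)
    (X : set M) : set R :=
  [set a | 0 <= a /\ forall x, X x -> exists y, X y /\ mdist x y = a].

(* The library puts the usual metric of R on the alias R^o. *)
Lemma mdist_realE (R : realType) (x y : R^o) : mdist x y = `|x - y|.
Proof. exact: distrC. Qed.

(* Main.v *)
Require Import Defs.
From mathcomp Require Import all_boot all_order all_algebra.
From mathcomp Require Import all_classical all_reals all_analysis.
From mathcomp Require Import ring lra zify.

Set Implicit Arguments.
Unset Strict Implicit.
Unset Printing Implicit Defensive.

Import Order.TTheory GRing.Theory Num.Theory.
Import numFieldNormedType.Exports.

Local Open Scope classical_set_scope.
Local Open Scope ring_scope.

(** Choose reals t_i (i in R) and rational subspaces W_i of R, increasing in i,
    with t_i outside W_i, such that each x that is not in all W_i has a leading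
    term: x = q t_i modulo W_i with q a nonzero rational, i and q being unique.
    Attach to i a distance d_i so that every positive real occurs as d_i for
    arbitrarily large i. Let X consist of the x having no leading term, or
    whose leading coefficient q is < 0, > 1, or equal to 1 with x different
    from t_i + d_i and t_i - d_i whenever d_i is not in A.
    - If b > 0 is not in A, pick i with d_i = b and b in W_i: then t_i is in X
      but t_i + b and t_i - b, both with leading term t_i, are not.
    - Let x be in X and a in A. If a has a nonzero coefficient at the larger of
      the two leading indices, then one of x + a, x - a has a leading
      coefficient < 0 or > 1, because 0 < q < 1 is excluded for x. Otherwise
      both have the leading term of x, and they cannot both be removed: that
      would force a = 0 or x = t_i and a = d_i, which is not in A.
    The t_i are the numbers sum_(k in S_i) 2^(-k^2) for an almost disjoint
    family of infinite sets S_i, here the codes of the pairs (n, floor(n i));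
    they are linearly independent over the rationals. W_i is spanned by the
    t_j, j < i, and a rational complement of the span of all t_j. *)

(** * Sums of 2^(-k^2) over sets of natural numbers *)

Section SquareSeries.
Variable R : realType.
Implicit Types (S : pred nat) (x : R).

Definition sqexp (n : nat) : R := 2^-1 ^+ (n * n).

Lemma sqexp_gt0 n : 0 < sqexp n.
Proof. by rewrite exprn_gt0. Qed.

Lemma sqexpS n : sqexp n = 2 ^+ n.*2.+1 * sqexp n.+1.
Proof.
have -> : sqexp n.+1 = 2^-1 ^+ n.*2.+1 * sqexp n.
  by rewrite /sqexp -exprD; congr (_ ^+ _); lia.
by rewrite mulrA -exprMn divff // expr1n mul1r.
Qed.

Lemma sqexpS_le n : 2 * sqexp n.+1 <= sqexp n.
Proof.
rewrite (sqexpS n) ler_pM2r ?sqexp_gt0 // exprS ler_peMr //.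
by apply: exprn_ege1; rewrite ler1n.
Qed.

Definition partial_sum S (n : nat) : R := \sum_(k < n) (S k)%:R * sqexp k.

Definition square_sum S : R := sup (range (partial_sum S)).

Lemma partial_sum_le S m n : (m <= n)%N -> partial_sum S m <= partial_sum S n.
Proof.
move/subnKC => <-; elim: (n - m)%N => [|k IH]; first by rewrite addn0.
rewrite addnS; apply: (le_trans IH); rewrite /partial_sum big_ord_recr /=.
by rewrite lerDl mulr_ge0 // ltW // sqexp_gt0.
Qed.

(** Each [sqexp] is at least twice the next, so [2 * sqexp m] bounds the sum of all terms from [m]
    on. *)
Lemma partial_sum_tail S m n : (m <= n)%N ->
  partial_sum S n + 2 * sqexp n <= partial_sum S m + 2 * sqexp m.
Proof.
move/subnKC => <-; elim: (n - m)%N => [|k IH]; first by rewrite addn0.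
rewrite addnS; apply: le_trans IH; rewrite /partial_sum big_ord_recr /=.
have := sqexpS_le (m + k); have := sqexp_gt0 (m + k).
by case: (S _) => /=; lra.
Qed.

Lemma partial_sum_ub S m : ubound (range (partial_sum S))
  (partial_sum S m + 2 * sqexp m).
Proof.
move=> _ [n _ <-]; have := partial_sum_tail S (leq_maxl m n).
have := partial_sum_le S (leq_maxr m n); have := sqexp_gt0 (maxn m n); lra.
Qed.

Lemma square_sum_approx S n :
  `|square_sum S - partial_sum S n| <= 2 * sqexp n.
Proof.
have lb : partial_sum S n <= square_sum S.
  apply: ub_le_sup; last by exists n.
  by exists (partial_sum S n + 2 * sqexp n); exact: partial_sum_ub.
have ub : square_sum S <= partial_sum S n + 2 * sqexp n.
  by apply: ge_sup; [exists (partial_sum S 0), 0%N | exact: partial_sum_ub].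
by rewrite ger0_norm; lra.
Qed.

(* The gaps between consecutive squares are unbounded, so a fast convergence
   rate forces integer coefficients to vanish eventually. *)
Lemma int_coef_eventually0 (c : nat -> int) (K : nat) :
  (forall n, `|\sum_(k < n) (c k)%:~R * sqexp k| <= K%:R * sqexp n) ->
  forall n, (K < n)%N -> c n = 0.
Proof.
move=> cK.
pose s n := \sum_(k < n) (c k)%:~R * sqexp k.
have sZ n : exists z : int, s n.+1 = z%:~R * sqexp n.
  elim: n => [|n [z sz]]; first by exists (c 0%N); rewrite /s big_ord1.
  exists (z * 2 ^+ n.*2.+1 + c n.+1).
  rewrite /s big_ord_recr /= -/(s n.+1) sz (sqexpS n).
  rewrite rmorphD rmorphM rmorphXn /=.
  ring.
(* An integer multiple of [sqexp n] vanishes if bounded by [K%:R * sqexp n.+1], which is below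
   [sqexp n] for [K <= n]. *)
have s0 n : (K <= n)%N -> s n.+1 = 0.
  move=> Kn; have [z sz] := sZ n.
  have := cK n.+1; rewrite -/(s n.+1) sz normrM (gtr0_norm (sqexp_gt0 n)).
  rewrite (sqexpS n) mulrA ler_pM2r ?sqexp_gt0 // => zK.
  have [->|z0] := eqVneq z 0; first by rewrite mul0r.
  have z1 : 1 <= `|z%:~R| :> R by rewrite -intr_norm ler1z -gtz0_ge1 normr_gt0.
  suff : (K%:R : R) < 2 ^+ n.*2.+1.
    by rewrite ltNge (le_trans _ zK) // ler_peMl // exprn_ge0.
  rewrite -natrX ltr_nat; apply: leq_ltn_trans (ltn_expl n.*2.+1 (ltnSn 1)).
  lia.
move=> [//|n] Kn; apply/eqP; rewrite -(intr_eq0 R).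
have := s0 n.+1; rewrite leqW // /s big_ord_recr /= -/(s n.+1) s0 // add0r.
by move/(_ isT)/eqP; rewrite mulf_eq0 (gt_eqF (sqexp_gt0 _)) orbF.
Qed.

(* The empty set is allowed, so that unions of arbitrary chains qualify. *)
Definition rat_closed (V : set R) :=
  (forall x y, V x -> V y -> V (x + y)) /\
  (forall (q : rat) x, V x -> V (ratr q * x)).

(* The rational subspace of the reals having, up to a positive integer factor,
   an expansion along 2^(-k^2) whose integer coefficients vanish at all large
   k in S; it separates square_sum S from square_sum T for T almost disjoint
   from S. *)
Definition sparse_on S : set R :=
  [set x | exists D K N (c : nat -> int),
     [/\ (0 < D)%N,
         forall n, `|D%:R * x - \sum_(k < n) (c k)%:~R * sqexp k| <=
                   K%:R * sqexp n
       & forall k, (N <= k)%N -> S k -> c k = 0]].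

Lemma sparse_on_rat_closed S : rat_closed (sparse_on S).
Proof.
split=> [x y [D [K [N [c [D0 cK cS]]]]] [D' [K' [N' [c' [D0' cK' cS']]]]]|].
  exists (D * D')%N, (D' * K + D * K')%N, (maxn N N').
  exists (fun k => D'%:Z * c k + D%:Z * c' k); split.
  - by rewrite muln_gt0 D0.
  - move=> n.
    have -> : (D * D')%:R * (x + y) -
        \sum_(k < n) (D'%:Z * c k + D%:Z * c' k)%:~R * sqexp k =
        D'%:R * (D%:R * x - \sum_(k < n) (c k)%:~R * sqexp k) +
        D%:R * (D'%:R * y - \sum_(k < n) (c' k)%:~R * sqexp k).
      have -> : \sum_(k < n) (D'%:Z * c k + D%:Z * c' k)%:~R * sqexp k =
          D'%:R * (\sum_(k < n) (c k)%:~R * sqexp k) +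
          D%:R * (\sum_(k < n) (c' k)%:~R * sqexp k).
        rewrite !mulr_sumr -big_split; apply: eq_bigr => k _ /=.
        by rewrite rmorphD !rmorphM /= mulrDl !mulrA !pmulrn.
      by rewrite natrM; ring.
    apply: le_trans (ler_normD _ _) _; rewrite !normrM !normr_nat.
    rewrite natrD !natrM mulrDl -!mulrA.
    by apply: lerD; apply: ler_wpM2l.
  - move=> k; rewrite geq_max => /andP[Nk N'k] Sk.
    by rewrite cS // cS' // !mulr0 addr0.
move=> q x [D [K [N [c [D0 cK cS]]]]].
have d0 : (denq q)%:~R != 0 :> R by rewrite intr_eq0 denq_neq0.
exists (`|denq q| * D)%N, (`|numq q| * K)%N, N, (fun k => numq q * c k); split.
- by rewrite muln_gt0 D0 absz_gt0 denq_neq0.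
- move=> n.
  have -> : (`|denq q| * D)%:R * (ratr q * x) -
      \sum_(k < n) (numq q * c k)%:~R * sqexp k =
      (numq q)%:~R * (D%:R * x - \sum_(k < n) (c k)%:~R * sqexp k).
    rewrite mulrBr mulr_sumr; congr (_ - _); last first.
      by apply: eq_bigr => k _; rewrite rmorphM /= mulrA.
    by rewrite natrM natr_absz (gtr0_norm (denq_gt0 q)) /ratr; field.
  rewrite normrM natrM natr_absz -mulrA intr_norm.
  by apply: ler_wpM2l.
- by move=> k Nk Sk; rewrite cS // mulr0.
Qed.

Lemma square_sum_sparse_on S T N :
  (forall k, (N <= k)%N -> ~~ (S k && T k)) -> sparse_on S (square_sum T).
Proof.
move=> ST; exists 1%N, 2%N, N, (fun k => (T k : nat)%:Z); split=> //.
  by move=> n; rewrite mul1r; exact: square_sum_approx.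
by move=> k /ST + Sk; rewrite Sk; case: (T k).
Qed.

(** The coefficients [D * S k - c k] have partial sums of order [sqexp n], so they vanish
    eventually; at a large [k] in [S], where [c k = 0], this gives [D = 0]. *)
Lemma square_sum_not_sparse_on S :
  (forall N, exists2 k, (N <= k)%N & S k) -> ~ sparse_on S (square_sum S).
Proof.
move=> Sinf [D [K [N [c [D0 cK cS]]]]].
have [k] := Sinf (maxn N (K + D * 2).+1); rewrite geq_max => /andP[Nk Kk] Sk.
have : D%:Z * (S k : nat) - c k = 0.
  apply: (@int_coef_eventually0 (fun k => D%:Z * (S k : nat) - c k)
           (K + D * 2)) => // n.
  have -> : \sum_(k < n) (D%:Z * (S k : nat) - c k)%:~R * sqexp k =
     (D%:R * square_sum S - \sum_(k < n) (c k)%:~R * sqexp k) -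
     D%:R * (square_sum S - partial_sum S n).
    have -> : \sum_(k < n) (D%:Z * (S k : nat) - c k)%:~R * sqexp k =
      D%:R * partial_sum S n - \sum_(k < n) (c k)%:~R * sqexp k.
      rewrite mulr_sumr -sumrB; apply: eq_bigr => j _ /=.
      by rewrite rmorphB rmorphM /= mulrBl !mulrA !pmulrn.
    ring.
  apply: le_trans (ler_normB _ _) _; rewrite natrD natrM mulrDl -mulrA.
  apply: lerD => //; rewrite normrM normr_nat.
  by apply: ler_wpM2l => //; exact: square_sum_approx.
by rewrite cS // Sk; lia.
Qed.

End SquareSeries.

(** * An almost disjoint family and independent reals *)

Section Filtration.
Variable R : realType.
Implicit Types (V U G : set R) (x y : R).

Definition slope_codes (r : R) : pred nat :=
  [pred k | `[< exists n : nat, k = pickle (n, Num.floor (n%:R * r)) >]].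

Lemma slope_codes_unbounded r N : exists2 k, (N <= k)%N & slope_codes r k.
Proof.
pose f n := pickle (n, Num.floor (n%:R * r)).
have [[n nN]|noN] := pselect (exists n, (N <= f n)%N).
  by exists (f n) => //; apply/asboolP; exists n.
have ltN n : (f n < N)%N.
  by rewrite ltnNge; apply/negP => le; apply: noN; exists n.
pose g (n : 'I_N.+1) : 'I_N := Ordinal (ltN n).
have /leq_card : injective g.
  by move=> n m [] /(pcan_inj pickleK) [] /val_inj.
by rewrite !card_ord ltnn.
Qed.

(** A common code comes from a single [n], and equal floors of [n r] and [n s] give
    [n |r - s| <= 1], which bounds [n]. *)
Lemma slope_codes_almost_disjoint r s : r != s ->
  exists N, forall k, (N <= k)%N -> ~~ (slope_codes r k && slope_codes s k).
Proof.
move=> rs; have d0 : 0 < `|r - s| by rewrite normr_gt0 subr_eq0.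
pose m := Num.bound (`|r - s|^-1).
exists (\max_(n < m) pickle (n : nat, Num.floor (n%:R * r))).+1 => k.
apply: contraL => /andP[/asboolP[n kn] /asboolP[n' kn']].
have := etrans (esym kn') kn => /(pcan_inj pickleK) [? fl]; subst n'.
rewrite -ltnNge ltnS kn.
have nm : (n < m)%N.
  rewrite ltnNge; apply/negP => mn.
  have : 1 < n%:R * `|r - s|.
    rewrite -ltr_pdivrMr // div1r; apply: lt_le_trans (archi_boundP _) _.
      by rewrite invr_ge0 ltW.
    by rewrite ler_nat.
  rewrite -[n%:R]normr_nat -normrM mulrBr ltNge => /negP; apply.
  have /andP[] := floor_itv (n%:R * r); have /andP[] := floor_itv (n%:R * s).
  rewrite fl rmorphD /= => *; rewrite ler_norml; lra.
exact: (@leq_bigmax _ (fun n : 'I_m => pickle (n : nat, Num.floor (n%:R * r)))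
  (Ordinal nm)).
Qed.

(** The subspaces [U] express linear independence without mentioning linear combinations. *)
Lemma exists_rat_independent : exists t : R -> R, forall i,
  exists U, [/\ rat_closed U, forall j, j != i -> U (t j) & ~ U (t i)].
Proof.
exists (fun r => square_sum R (slope_codes r)) => i.
exists (@sparse_on R (slope_codes i)); split.
- exact: sparse_on_rat_closed.
- move=> j ji; have [|N NP] := @slope_codes_almost_disjoint i j.
    by rewrite eq_sym.
  exact: square_sum_sparse_on NP.
- by apply: square_sum_not_sparse_on => N; exact: slope_codes_unbounded.
Qed.

(** * Rational subspaces, spans and complements *)

Section RatClosed.
Variable V : set R.
Hypothesis Vc : rat_closed V.

Lemma rat_closedD x y : V x -> V y -> V (x + y).
Proof. exact: Vc.1. Qed.

Lemma rat_closedZ (q : rat) x : V x -> V (ratr q * x).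
Proof. exact: Vc.2. Qed.

Lemma rat_closed0 x : V x -> V 0.
Proof. by move/(rat_closedZ 0); rewrite rmorph0 mul0r. Qed.

Lemma rat_closedN x : V x -> V (- x).
Proof.
by move=> Vx; rewrite -mulN1r -(rmorph1 (@ratr R)) -rmorphN; exact: Vc.2.
Qed.

Lemma rat_closedB x y : V x -> V y -> V (x - y).
Proof. by move=> Vx /rat_closedN; exact: rat_closedD. Qed.

Lemma rat_closedZK (q : rat) x : q != 0 -> V (ratr q * x) -> V x.
Proof.
move=> q0 /(rat_closedZ q^-1).
by rewrite mulrA -rmorphM /= mulVf // rmorph1 mul1r.
Qed.

End RatClosed.

Definition rat_span G : set R := smallest (@rat_closed R) G.

Lemma mem_rat_span G x : G x -> rat_span G x.
Proof. exact: sub_gen_smallest. Qed.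

Lemma rat_span_sub G V : rat_closed V -> G `<=` V -> rat_span G `<=` V.
Proof. exact: smallest_sub. Qed.

Lemma rat_span_closed G : rat_closed (rat_span G).
Proof.
split=> [x y Gx Gy|q x Gx] V [Vc GV].
  by apply: (rat_closedD Vc); [exact: Gx | exact: Gy].
by apply: (rat_closedZ Vc); exact: Gx.
Qed.

Definition sumset V U : set R :=
  [set x | exists v u, [/\ V v, U u & x = v + u]].

Lemma rat_closed_sum V U : rat_closed V -> rat_closed U ->
  rat_closed (sumset V U).
Proof.
move=> Vc Uc; split.
  move=> _ _ [v [u [Vv Uu ->]]] [v' [u' [Vv' Uu' ->]]].
  exists (v + v'), (u + u'); split; last by rewrite addrACA.
    exact: rat_closedD.
  exact: rat_closedD.
move=> q _ [v [u [Vv Uu ->]]]; exists (ratr q * v), (ratr q * u).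
by split; rewrite ?mulrDr //; exact: rat_closedZ.
Qed.

Definition rat_line x : set R := [set y | exists q : rat, y = ratr q * x].

Lemma rat_closed_line x : rat_closed (rat_line x).
Proof.
split=> [_ _ [q ->] [q' ->]|p _ [q ->]].
  by exists (q + q'); rewrite rmorphD mulrDl.
by exists (p * q); rewrite rmorphM mulrA.
Qed.

Lemma exists_rat_complement U : rat_closed U -> U 0 ->
  exists V, [/\ rat_closed V, V 0, forall x, V x -> U x -> x = 0 &
    forall x, sumset V U x].
Proof.
move=> Uc U0.
pose P V := rat_closed V /\ forall x, V x -> U x -> x = 0.
have [F FP Ftot|V [[Vc VU] Vmax]] := @Zorn_bigcup _ P.
  split; last by move=> x [V FV Vx]; exact: (FP _ FV).2.
  split=> [x y [V FV Vx] [V' FV' V'y]|q x [V FV Vx]]; last first.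
    by exists V => //; exact: (rat_closedZ (FP _ FV).1).
  have [VV'|V'V] := Ftot _ _ FV FV'.
    by exists V' => //; apply: (rat_closedD (FP _ FV').1) => //; exact: VV'.
  by exists V => //; apply: (rat_closedD (FP _ FV).1) => //; exact: V'V.
have V0 : V 0.
  have [[x Vx]|noV] := pselect (exists x, V x).
    exact: rat_closed0 Vx.
  (* An empty [V] is not maximal, as [[set 0]] also qualifies. *)
  exfalso; apply: (Vmax [set 0]).
    split=> [x Vx|H]; first by case: noV; exists x.
    by apply: noV; exists 0; exact: H.
  split=> [|x -> //]; split=> [x y -> ->|q x ->] /=; first by rewrite addr0.
  by rewrite mulr0.
exists V; split=> // x; apply: contrapT => nx.
have Sc := rat_closed_sum Vc (rat_closed_line x).
apply: (Vmax (sumset V (rat_line x))).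
  split=> [v Vv|V'V].
    exists v, 0; split=> //; last by rewrite addr0.
    by exists 0; rewrite rmorph0 mul0r.
  apply: nx; exists x, 0; split; rewrite ?addr0 //.
  apply: V'V; exists 0, x; split; rewrite ?add0r //.
  by exists 1; rewrite rmorph1 mul1r.
split=> // _ [v [_ [Vv [q ->] ->]]].
have [->|q0 Uvx] := eqVneq q 0.
  by rewrite rmorph0 mul0r addr0; exact: VU.
case: nx; have q0R : ratr q != 0 :> R by rewrite fmorph_eq0.
(* Solving for [x] puts it in [V + U], against [nx]. *)
exists (ratr q^-1 * - v), (ratr q^-1 * (v + ratr q * x)); split.
- by apply: (rat_closedZ Vc); exact: rat_closedN.
- exact: rat_closedZ.
- by rewrite fmorphV; field.
Qed.

(** * The filtration and leading terms *)

Lemma exists_filtration : exists (t : R -> R) (W : R -> set R),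
  [/\ forall i, rat_closed (W i),
      forall i, ~ W i (t i),
      forall i j, i < j -> W i `<=` W j /\ W j (t i)
    & forall x, (forall i, W i x) \/
        exists i (q : rat), q != 0 /\ W i (x - ratr q * t i)].
Proof.
have [t tP] := exists_rat_independent.
pose T := rat_span (range t).
have Tc : rat_closed T by exact: rat_span_closed.
have Tt i : T (t i) by apply: mem_rat_span; exists i.
have T0 : T 0 by exact: (rat_closed0 Tc (Tt 0)).
have [V [Vc V0 VT VTx]] := exists_rat_complement Tc T0.
pose W i := rat_span (V `|` [set t j | j in [set j | j < i]]).
have Wc i : rat_closed (W i) by exact: rat_span_closed.
have VW i : V `<=` W i by move=> x Vx; apply: mem_rat_span; left.
have tW i j : i < j -> W j (t i).
  by move=> ij; apply: mem_rat_span; right; exists i.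
have sW i j : i < j -> W i `<=` W j.
  move=> ij; apply: rat_span_sub; first exact: Wc.
  move=> y [/VW //|[k /= ki <-]]; apply: tW; exact: lt_trans ij.
exists t, W; split=> //.
  move=> i Wi.
  pose U := rat_span [set t j | j in [set j | j < i]].
  have Uc : rat_closed U by exact: rat_span_closed.
  have UT : U `<=` T.
    by apply: rat_span_sub => // _ [k _ <-].
  (* The span of no elements would be empty; [i - 1] is just some index below [i]. *)
  have U0 : U 0.
    apply: (@rat_closed0 _ Uc (t (i - 1))).
    by apply: mem_rat_span; exists (i - 1) => //=; rewrite ltrBlDr ltrDl.
  have [v [u [Vv Uu tvu]]] : sumset V U (t i).
    apply: rat_span_sub Wi; first exact: rat_closed_sum.
    move=> x [Vx|Ux]; first by exists x, 0; rewrite addr0.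
    by exists 0, x; rewrite add0r; split=> //; exact: mem_rat_span.
  (* [v = t i - u] lies in both [V] and [T]; then [t i = u] is spanned by earlier [t j], against
     independence. *)
  have v0 : v = 0.
    apply: VT => //; have -> : v = t i - u by rewrite tvu addrK.
    by apply: (rat_closedB Tc) => //; exact: UT.
  have [U' [Uc' Ut' []]] := tP i.
  rewrite tvu v0 add0r; apply: rat_span_sub Uu => // _ [j /= ji <-].
  by apply: Ut'; rewrite lt_eqF.
  by move=> i j ij; split; [exact: sW | exact: tW].
move=> x; have [v [u [Vv Tu ->]]] := VTx x.
(* Finite generation lets the leading term be found by descending through a
   sorted list of generators. *)
pose span_of (s : seq R) := rat_span (V `|` [set t j | j in [set` s]]).
have Sc s : rat_closed (span_of s) by exact: rat_span_closed.
have [s] : exists s, span_of s (v + u).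
  have [s su] : [set u | exists s, span_of s u] u.
    apply: rat_span_sub Tu; last first.
      move=> _ [i _ <-]; exists [:: i]; apply: mem_rat_span; right.
      by exists i => //=; rewrite inE.
    split=> [y z [s sy] [s' sz]|q y [s sy]]; last first.
      by exists s; exact: (rat_closedZ (Sc s)).
    exists (s ++ s'); apply: (rat_closedD (Sc _)).
      move: y sy; apply: rat_span_sub => // y [Vy|[j /= js <-]].
        by apply: mem_rat_span; left.
      apply: mem_rat_span; right; exists j => //=.
      by rewrite mem_cat js.
    move: z sz; apply: rat_span_sub => // z [Vz|[j /= js <-]].
      by apply: mem_rat_span; left.
    apply: mem_rat_span; right; exists j => //=.
    by rewrite mem_cat js orbT.
  by exists s; apply: (rat_closedD (Sc _)) => //; apply: mem_rat_span; left.
pose r := sort >=%R (undup s).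
have -> : span_of s = span_of r.
  congr (rat_span (_ `|` _)); congr (_ @` _); apply/seteqP.
  by split=> j /=; rewrite mem_sort mem_undup.
have : sorted >=%R r by apply: sort_sorted => ? ?; exact: le_total.
have : uniq r by rewrite sort_uniq undup_uniq.
move: {v u Vv Tu}(v + u) r => {}x r {s}; elim: r x => [|i s IH] x.
  move=> _ _ Vx; left=> i; move: x Vx; apply: rat_span_sub => // x.
  by case=> [|[]] //; exact: VW.
move=> /= /andP[nis us] ps.
have lts j : j \in s -> j < i.
  move=> js; rewrite lt_neqAle (contraNneq _ nis) => [|<- //].
  by have /allP/(_ _ js) := order_path_min (rev_trans le_trans) ps.
move=> sx.
(* Split off the largest index [i]: if [q = 0] it drops out, otherwise it leads, since the other
   generators lie in [W i]. *)
have [w [_ [sw [q ->] ->]]] : sumset (span_of s) (rat_line (t i)) x.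
  apply: rat_span_sub sx; first exact: rat_closed_sum (rat_closed_line _).
  move=> y [Vy|[j + <-]].
    exists y, 0; split; rewrite ?addr0 //; first by apply: mem_rat_span; left.
    by exists 0; rewrite rmorph0 mul0r.
  rewrite /= inE => /predU1P[->|js].
    exists 0, (t i); split; rewrite ?add0r //.
      by apply: mem_rat_span; left.
    by exists 1; rewrite rmorph1 mul1r.
  exists (t j), 0; split; rewrite ?addr0 //.
    by apply: mem_rat_span; right; exists j.
  by exists 0; rewrite rmorph0 mul0r.
have [->|q0] := eqVneq q 0.
  by rewrite rmorph0 mul0r addr0; apply: IH => //; exact: path_sorted ps.
right; exists i, q; split=> //; rewrite addrK; move: w sw.
by apply: rat_span_sub => // y [/VW //|[j /lts ji <-]]; exact: tW.
Qed.

End Filtration.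

(** * The set X and its center of distances *)

Theorem theorem2 (R : realType) (A : set R)
    (A_ge0 : forall a : R, A a -> 0 <= a) (A0 : A 0) :
  exists X : set R^o, center_of_distances X = A.
Proof.
have [t [W [Wc Wt Wlt Wlead]]] := exists_filtration R.
(* By its periodicity, d takes each positive value b at all n + 1 / (b + 1). *)
pose d (i : R) := (i - (Num.floor i)%:~R)^-1 - 1.
(* At an integer [i], [d i = 0^-1 - 1 = -1] is no distance, so [ok i x] holds. *)
pose ok i x := ~ (`|x - t i| = d i /\ ~ A (d i)).
pose good i (q : rat) x := q < 0 \/ 1 < q \/ q = 1 /\ ok i x.
pose X : set R := [set x | forall i (q : rat), q != 0 ->
  W i (x - ratr q * t i) -> good i q x].
have Wup x i j q : W i (x - ratr q * t i) -> i < j -> W j x.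
  move=> Wx /Wlt[sij tj]; rewrite -(subrK (ratr q * t i) x).
  by apply: rat_closedD => //; [exact: sij | exact: rat_closedZ].
have notW x i (q : rat) : q != 0 -> W i (x - ratr q * t i) -> ~ W i x.
  move=> q0 Wq Wx; apply: (Wt i); apply: (rat_closedZK (Wc i) q0).
  by have := rat_closedB (Wc i) Wx Wq; rewrite subKr.
have Wuniq x i j (q p : rat) : q != 0 -> p != 0 -> W i (x - ratr q * t i) ->
    W j (x - ratr p * t j) -> i = j /\ q = p.
  move=> q0 p0 Wi Wj; have [ij|ji|ij] := ltgtP i j.
  - by case: (notW _ _ _ p0 Wj); exact: (Wup _ _ _ _ Wi ij).
  - by case: (notW _ _ _ q0 Wi); exact: (Wup _ _ _ _ Wj ji).
  subst j; split=> //; apply/eqP; rewrite -subr_eq0; apply/eqP.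
  apply: contrapT => /eqP qp0; apply: (Wt i).
  apply: (rat_closedZK (Wc i) qp0).
  have := rat_closedB (Wc i) Wj Wi.
  by rewrite rmorphB /=; congr (W i _); ring.
have leadX x i q : W i (x - ratr q * t i) -> q != 0 -> good i q x -> X x.
  by move=> Wx q0 gx j p p0 /(Wuniq _ _ _ _ _ q0 p0 Wx)[<- <-].
have X_W x : (forall i, W i x) -> X x.
  by move=> Wx i q q0 /(notW _ _ _ q0).
exists X; apply/seteqP; split=> [b [b0 Xb]|a Aa]; last first.
  split; first exact: A_ge0.
  move=> x Xx.
  suff [y Xy xy] : exists2 y, X y & `|x - y| = a.
    by exists y; rewrite mdist_realE.
  have a_ge0 := A_ge0 _ Aa.
  have take_plus : X (x + a) -> exists2 y, X y & `|x - y| = a.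
    by exists (x + a) => //; rewrite opprD addNKr normrN ger0_norm.
  have take_minus : X (x - a) -> exists2 y, X y & `|x - y| = a.
    by exists (x - a) => //; rewrite subKr ger0_norm.
  have lead_plus i (q p : rat) : W i (x - ratr q * t i) ->
      W i (a - ratr p * t i) -> W i (x + a - ratr (q + p) * t i).
    by move=> Wx Wa; rewrite rmorphD mulrDl opprD addrACA; exact: rat_closedD.
  have lead_minus i (q p : rat) : W i (x - ratr q * t i) ->
      W i (a - ratr p * t i) -> W i (x - a - ratr (q - p) * t i).
    move=> Wx Wa; have := rat_closedB (Wc i) Wx Wa.
    by rewrite rmorphB /=; congr (W i _); ring.
  (* Here [i] is the larger leading index; a zero coefficient means that the number lies in
     [W i]. *)
  have dominant i (q p : rat) : (q != 0) || (p != 0) ->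
      W i (x - ratr q * t i) -> W i (a - ratr p * t i) ->
      exists2 y, X y & `|x - y| = a.
    move=> qp Wx Wa; have Wp := lead_plus _ _ _ Wx Wa.
    have Wm := lead_minus _ _ _ Wx Wa.
    have : q = 0 \/ q < 0 \/ 1 < q \/ q = 1 /\ ok i x.
      have [->|q0] := eqVneq q 0; first by left.
      by right; exact: Xx Wx.
    have [p0|p0] := eqVneq p 0.
      rewrite p0 eqxx orbF in qp; subst p; rewrite addr0 in Wp.
      rewrite subr0 in Wm.
      case=> [q0|[q0|[q1|[q1 okx]]]]; first by rewrite q0 eqxx in qp.
      - by apply: take_plus; apply: (leadX _ _ _ Wp) => //; left.
      - by apply: take_plus; apply: (leadX _ _ _ Wp) => //; right; left.
      have [okp|/contrapT[dp nAd]] := pselect (ok i (x + a)).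
        by apply: take_plus; apply: (leadX _ _ _ Wp) => //; right; right.
      apply: take_minus; apply: (leadX _ _ _ Wm) => //.
      right; right; split=> //.
      case=> dm _.
      have [x0|xt] := eqVneq (x - t i) 0.
        by apply: nAd; rewrite -dp (addrAC x) x0 add0r ger0_norm.
      (* With [u = x - t i] nonzero, [|u + a| = |u - a|] forces [a = 0], and then [x] itself is
         removed. *)
      have a0 : a = 0.
        move: dp; rewrite -dm (addrAC x a) (addrAC x (- a)) => /eqP.
        by rewrite eqr_norm2 => /orP[] /eqP; move/eqP: xt => xt; lra.
      by apply: okx; rewrite a0 addr0 in dp.
    move=> Hq.
    (* Choose the sign that moves the coefficient [q] further away from the interval between 0 and
       1. *)
    have [neg|pos] : q <= 0 \/ 1 <= q.
      by case: Hq => [->|[/ltW|[/ltW|[-> _]]]]; auto.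
    - have [p_lt0|p_gt0|pe0] := ltgtP p 0; last by rewrite pe0 eqxx in p0.
        apply: take_plus; apply: (leadX _ _ _ Wp);
          first by rewrite lt_eqF //; lra.
        by left; lra.
      apply: take_minus; apply: (leadX _ _ _ Wm);
          first by rewrite lt_eqF //; lra.
      by left; lra.
    have [p_lt0|p_gt0|pe0] := ltgtP p 0; last by rewrite pe0 eqxx in p0.
      apply: take_minus; apply: (leadX _ _ _ Wm);
          first by rewrite gt_eqF //; lra.
      by right; left; lra.
    apply: take_plus; apply: (leadX _ _ _ Wp);
          first by rewrite gt_eqF //; lra.
    by right; left; lra.
  have W0 i y : W i y -> W i (y - ratr 0 * t i).
    by rewrite rmorph0 mul0r subr0.
  have [Wx|[i [q [q0 Wx]]]] := Wlead x.
    have [Wa|[i [p [p0 Wa]]]] := Wlead a.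
      by apply: take_plus; apply: X_W => i; exact: rat_closedD.
    apply: (dominant i 0 p) Wa; last exact: W0.
    by rewrite p0 orbT.
  have [Wa|[j [p [p0 Wa]]]] := Wlead a.
    apply: (dominant i q 0) Wx _; last exact: W0.
    by rewrite q0.
  have [ij|ji|ij] := ltgtP i j.
  - by apply: (dominant j 0 p) Wa; [rewrite p0 orbT |
      apply: W0; exact: (Wup _ _ _ _ Wx ij)].
  - by apply: (dominant i q 0) Wx _; [rewrite q0 |
      apply: W0; exact: (Wup _ _ _ _ Wa ji)].
  by subst j; apply: (dominant i q p) Wx Wa; rewrite q0.
apply: contrapT => nAb.
have {}b0 : 0 < b.
  by rewrite lt_neqAle b0 andbT; apply/eqP => b0'; apply: nAb; rewrite -b0'.
pose above n : R := n%:~R + (b + 1)^-1.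
have d_above n : d (above n) = b.
  have b1 : 0 <= (b + 1)^-1 < 1.
    by rewrite invr_ge0 invf_lt1; lra.
  have fl : Num.floor (above n) = n.
    by apply: floor_def; rewrite /above rmorphD /=; case/andP: b1; lra.
  by rewrite /d fl /above [n%:~R + _]addrC addrK invrK addrK.
have [n Wb] : exists n, W (above n) b.
  have [Wb|[i [q [q0 Wb]]]] := Wlead b; first by exists 0.
  (* This makes [above n] exceed the leading index [i] of [b]. *)
  exists (Num.floor i + 1); apply: (Wup _ _ _ _ Wb).
  have /andP[_ h] := floor_itv i; apply: (lt_trans h).
  by rewrite ltrDl invr_gt0; lra.
set i := above n in Wb.
have Wti y : W i (y - t i) -> W i (y - ratr 1 * t i) by rewrite rmorph1 mul1r.
have Xt : X (t i).
  apply: (leadX _ i 1) => //.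
    by apply: Wti; have := rat_closedB (Wc i) Wb Wb; rewrite !subrr.
  right; right; split=> // -[]; rewrite subrr normr0 d_above => b0' _.
  by rewrite b0' ltxx in b0.
have [y [Xy]] := Xb _ Xt; rewrite mdist_realE => ty.
(* [y] is [t i + b] or [t i - b], and [b] is in [W i], so its leading term is [t i]; being at
   distance [b = d i] from [t i], it was removed from [X]. *)
have Wy : W i (y - ratr 1 * t i).
  apply: Wti; have /orP[/eqP e|/eqP e] : (t i - y == b) || (t i - y == - b).
  - by have /eqP := ty; rewrite eqr_norml => /andP[].
  - by have := rat_closedN (Wc i) Wb; rewrite -e opprB.
  - by move: Wb; rewrite -[b]opprK -e opprB.
have := Xy i 1 (oner_neq0 _) Wy; rewrite /good ltxx ltr10.
by case=> // -[] // [_]; apply; rewrite distrC d_above.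
Qed.
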